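(* For every $n\ge 3$, the M\''obius ladder of length $n$ and the $n$-prism $C_n\square P_2$ have the same optimal rubbling number.
   Context: The ladder $P_n\square P_2$ has upper path $v_1,\dots,v_n$, lower path $w_1,\dots,w_n$ and rungs $\{v_i,w_i\}$. The $n$-prism $C_n\square P_2$ is obtained by adding the edges $\{v_1,v_n\}$ and $\{w_1,w_n\}$; the M\''obius ladder of length $n$ is obtained instead by adding the edges $\{v_1,w_n\}$ and $\{w_1,v_n\}$ (so that the two paths form a cycle $C_{2n}$). A pebble distribution is a function $p:V\to\mathbb{Z}_{\ge0}$; its size is the total number of pebbles. A pebbling move along an edge $\{v,u\}$ removes two pebbles from $v$ and adds one at $u$; a strict rubbling move $(v,w\to u)$ with $v\neq w$ both adjacent to $u$ removes one pebble from each of $v,w$ and adds one at $u$; rubbling moves are either kind. A sequence of moves is executable if pebble counts stay nonnegative throughout. A vertex is reachable if some executable sequence puts at least one pebble on it; a distribution is solvable if every vertex is reachable. The optimal rubbling number of a graph is the minimum size of a solvable distribution. *)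

(* Defs.v *)
(* MathComp world, with classical reasoning from mathcomp.classical.boolp. *)
From mathcomp Require Import all_boot.
From mathcomp.classical Require Import boolp.

Set Implicit Arguments.
Unset Strict Implicit.
Unset Printing Implicit Defensive.

Record sgraph := SGraph {
  vertex :> finType;
  adj : rel vertex;
  adj_sym : symmetric adj;
  adj_irrefl : irreflexive adj }.

Section GraphOfEdges.
Variables (T : finType) (r : rel T).

Definition edges_adj : rel T := [rel x y | (x != y) && (r x y || r y x)].

Lemma edges_adj_sym : symmetric edges_adj.
Proof. by move=> x y; rewrite /edges_adj /= eq_sym orbC. Qed.

Lemma edges_adj_irrefl : irreflexive edges_adj.
Proof. by move=> x; rewrite /edges_adj /= eqxx. Qed.

(* Each edge {x, y} needs to be listed by r in one direction only; loops are
   discarded. *)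
Definition graph_of_edges : sgraph := SGraph edges_adj_sym edges_adj_irrefl.

End GraphOfEdges.

(* Indices are shifted by one: (i, false) is v_(i+1) and (i, true) is
   w_(i+1). *)
Definition ladder_edge n : rel ('I_n * bool) :=
  [rel x y : 'I_n * bool |
    (x.2 == y.2) && (x.1.+1 == y.1 :> nat)
    || (x.1 == y.1) && (x.2 != y.2)].

Definition first_last n : rel ('I_n * bool) :=
  [rel x y : 'I_n * bool | (x.1 == 0 :> nat) && (y.1.+1 == n)].

(* For n <= 2 the closing edges are loops or edges of the ladder, or (Moebius,
   n = 2) its two diagonals; the usual graphs are obtained for n >= 3. *)
Definition prism n : sgraph :=
  graph_of_edges [rel x y : 'I_n * bool |
    ladder_edge x y || first_last x y && (x.2 == y.2)].

Definition moebius_ladder n : sgraph :=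
  graph_of_edges [rel x y : 'I_n * bool |
    ladder_edge x y || first_last x y && (x.2 != y.2)].

Section Rubbling.
Variable G : sgraph.

Definition distribution := {ffun G -> nat}.

Definition dsize (p : distribution) : nat := \sum_(x : G) p x.

Inductive move :=
  | Pebbling (v u : G)          (* two pebbles from v, one to u *)
  | StrictRubbling (v w u : G). (* one pebble from each of v and w, one to u *)

Definition legal (m : move) : bool :=
  match m with
  | Pebbling v u => adj v u
  | StrictRubbling v w u => [&& v != w, adj v u & adj w u]
  end.

Definition removed (m : move) (x : G) : nat :=
  match m with
  | Pebbling v _ => 2 * (x == v)
  | StrictRubbling v w _ => (x == v) + (x == w)
  end.

Definition added (m : move) (x : G) : nat :=
  match m with
  | Pebbling _ u | StrictRubbling _ _ u => x == u
  end.

(* The subtraction is truncated; executable excludes the case where it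
   matters. *)
Definition apply_move (p : distribution) (m : move) : distribution :=
  [ffun x => p x - removed m x + added m x].

Fixpoint executable (p : distribution) (s : seq move) : bool :=
  if s is m :: s' then
    [&& legal m, [forall x, removed m x <= p x] &
        executable (apply_move p m) s']
  else true.

(* The sequence may be empty: a vertex carrying a pebble is reachable. *)
Definition reachable (p : distribution) (x : G) : Prop :=
  exists2 s : seq move, executable p s & 0 < foldl apply_move p s x.

Definition solvable (p : distribution) : Prop := forall x, reachable p x.

Definition solvable_size (k : nat) : Prop :=
  exists2 p : distribution, solvable p & dsize p = k.

Lemma ex_solvable_size : exists k, `[< solvable_size k >].
Proof.
exists (dsize [ffun => 1]); apply/asboolP; exists [ffun => 1] => // x.
by exists [::] => //=; rewrite ffunE.
Qed.

Definition optimal_rubbling_number : nat := ex_minn ex_solvable_size.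

End Rubbling.

(* Main.v *)
(* Both graphs have optimal rubbling number ceil(2n/3), except that it is 3
   for n = 3.

   Lower bound.  Let D(x) be the integer part of the sum over the columns at
   distance d >= 0 to the left of x of 2^-d (2 p(x') + p(x'')), where x' is
   the vertex of that column in the row of x and x'' the other one (on the
   infinite ladder covering the graph), and let D' be the mirror image of D.
   No move increases D(left x) + 2 (2 p(x) + p(rung x)) + D'(right x), so this
   is at least 4 when x is reachable.  Moreover D(x) = 2 p(x) + p(rung x) +
   floor(D(left x) / 2).  With s(x) = D(x) + D(rung x), s' likewise for D',
   and c(x) = p(x) + p(rung x), these two facts give
     4 + max(s(x) - 2, 0) + max(s'(x) - 2, 0)
       <= 6 c(x) + max(s(left x) - 2, 0) + max(s'(right x) - 2, 0),
   which telescopes when summed over all vertices.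

   Upper bound.  For n >= 5 put pebbles on v_1, w_2, v_4, w_5, v_7, w_8, ...:
   two pebbles on a diagonal reach every vertex of their two columns, and a
   vertex of an empty column is reached from the pebbles on both sides,
   whatever the twist. *)
Require Import Defs.
From mathcomp Require Import all_boot.
From mathcomp Require Import all_fingroup zify.
From mathcomp.classical Require Import boolp.

Set Implicit Arguments.
Unset Strict Implicit.
Unset Printing Implicit Defensive.

Section RubblingTheory.
Variable G : sgraph.
Implicit Types (p q : distribution G) (x y u v w : G) (l : seq G).

Definition addd p q : distribution G := [ffun x => p x + q x].

Definition pebbles l : distribution G := [ffun x => count_mem x l].

Lemma executable_cat p s1 s2 :
  executable p (s1 ++ s2) =
  executable p s1 && executable (foldl (@apply_move G) p s1) s2.
Proof. by elim: s1 p => //= m s IHs p; rewrite IHs !andbA. Qed.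

Lemma executable_add p q s : executable p s ->
  executable (addd p q) s /\
  foldl (@apply_move G) (addd p q) s = addd (foldl (@apply_move G) p s) q.
Proof.
elim: s p => [|m s IHs] p //= /and3P[lm /forallP le_p ex_s].
have -> : apply_move (addd p q) m = addd (apply_move p m) q.
  by apply/ffunP=> x; rewrite !ffunE; have := le_p x; lia.
have [-> ->] := IHs _ ex_s; split=> //; rewrite lm andbT /=.
by apply/forallP=> x; rewrite ffunE (leq_trans (le_p x)) ?leq_addr.
Qed.

Lemma adddC p q : addd p q = addd q p.
Proof. by apply/ffunP=> x; rewrite !ffunE addnC. Qed.

Lemma reachable_pebbled p x : 0 < p x -> reachable p x.
Proof. by exists [::]. Qed.

Lemma reachable_le p q x :
  (forall y, p y <= q y) -> reachable p x -> reachable q x.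
Proof.
move=> le_pq [s ex_s lt_x].
have -> : q = addd p [ffun y => q y - p y].
  by apply/ffunP=> y; rewrite !ffunE subnKC.
have [ex_s' fin_s] := executable_add [ffun y => q y - p y] ex_s.
by exists s; rewrite ?fin_s // ffunE ltn_addr.
Qed.

Lemma reachable_join p q v w u : reachable p v -> reachable q w ->
  adj v u -> adj w u -> reachable (addd p q) u.
Proof.
move=> [s1 ex1 lt1] [s2 ex2 lt2] vu wu.
have [ex1' fin1] := executable_add q ex1.
have [ex2' fin2] := executable_add (foldl (@apply_move G) p s1) ex2.
pose m := if v == w then Pebbling v u else StrictRubbling v w u.
have lm : legal m by rewrite /m; case: eqVneq => [|nvw] //=; rewrite nvw vu.
have am : added m u = 1 by rewrite /m; case: ifP => _ /=; rewrite eqxx.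
exists (s1 ++ s2 ++ [:: m]).
  rewrite !executable_cat ex1' fin1 adddC ex2' fin2 /= lm andbT /=.
  apply/forallP=> x; rewrite ffunE /m; case: eqVneq => [eqvw|nvw] /=.
    by case: eqP => // ->; rewrite muln1 -[2]/(1 + 1) leq_add // eqvw.
  rewrite addnC; apply: leq_add; first by case: eqP => // ->.
  by case: eqP => // ->.
by rewrite !foldl_cat fin1 adddC fin2 /= ffunE am addn1.
Qed.

Lemma pebbles_join l1 l2 v w u :
  reachable (pebbles l1) v -> reachable (pebbles l2) w ->
  adj v u -> adj w u -> reachable (pebbles (l1 ++ l2)) u.
Proof.
move=> r1 r2 vu wu; have := reachable_join r1 r2 vu wu.
by congr reachable; apply/ffunP=> x; rewrite !ffunE count_cat.
Qed.

Lemma pebbles1 x : reachable (pebbles [:: x]) x.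
Proof. by apply: reachable_pebbled; rewrite ffunE /= eqxx. Qed.

Lemma reachable_pebbles p l x :
  all (fun y => count_mem y l <= p y) l ->
  reachable (pebbles l) x -> reachable p x.
Proof.
move=> /allP le_p; apply: reachable_le => y; rewrite ffunE.
have [/le_p //|] := boolP (y \in l).
by rewrite -has_pred1 has_count; case: count.
Qed.

Lemma dsize_pebbles l : dsize (pebbles l) = size l.
Proof.
rewrite /dsize; elim: l => [|x l IHl]; first by apply: big1 => y; rewrite ffunE.
rewrite -[size _]/(size l).+1 -IHl -addn1 addnC.
under eq_bigr do rewrite ffunE /=.
rewrite big_split /=; congr (_ + _); last by apply: eq_bigr => y; rewrite ffunE.
by rewrite (bigD1 x) //= eqxx big1 ?addn0 // => y; rewrite eq_sym => /negbTE->.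
Qed.

Lemma optimal_rubbling_numberP k :
  (exists2 p : distribution G, solvable p & dsize p = k) ->
  (forall p : distribution G, solvable p -> k <= dsize p) ->
  optimal_rubbling_number G = k.
Proof.
move=> ex_k min_k; rewrite /optimal_rubbling_number; case: ex_minnP => j.
move=> /asboolP[p sol_p dp] min_j; apply/eqP; rewrite eqn_leq.
by rewrite min_j -?dp ?min_k //; apply/asboolP.
Qed.

(* Both kinds of moves at once: v = w for a pebbling move. *)
Lemma legalP (m : move G) : legal m ->
  exists v w u, [/\ adj v u, adj w u,
    forall x, removed m x = (x == v) + (x == w) &
    forall x, added m x = (x == u)].
Proof.
case: m => [v u|v w u] /=; last by case/and3P=> _ vu wu; exists v, w, u.
by move=> vu; exists v, v, u; split=> // x; rewrite mul2n addnn.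
Qed.

Lemma sum_indicator x : \sum_(y : G) (y == x) = 1.
Proof. by rewrite (bigD1 x) //= eqxx big1 // => y /negbTE->. Qed.

Lemma dsize_move p m : legal m -> (forall x, removed m x <= p x) ->
  dsize p = (dsize (apply_move p m)).+1.
Proof.
move=> /legalP[v [w [u [_ _ rm am]]]] le_p; 
have H : dsize p + \sum_(x : G) added m x =
    dsize (apply_move p m) + \sum_(x : G) removed m x.
  rewrite -!big_split; apply: eq_bigr => x _ /=; rewrite ffunE.
  by have := le_p x; lia.
move: H; under eq_bigr do rewrite am.
under [X in _ = _ + X]eq_bigr do rewrite rm.
by rewrite big_split /= !sum_indicator; lia.
Qed.

Lemma dsize_apply_gt0 p m : legal m -> 0 < dsize (apply_move p m).
Proof.
move=> /legalP[v [w [u [_ _ _ am]]]].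
by rewrite /dsize (bigD1 u) //= ffunE am eqxx addn1.
Qed.

Lemma reachable_two p x : dsize p <= 2 -> p x = 0 -> reachable p x ->
  exists v w,
    [/\ 0 < p v, adj v x, adj w x & forall y, 0 < p y -> y = v \/ y = w].
Proof.
move=> le2 px0 [[|m s] /=]; first by rewrite px0.
case/and3P=> lm /forallP le_p ex_s.
have dp := dsize_move lm le_p.
have [v [w [u [vu wu rm am]]]] := legalP lm.
case: s ex_s => [_|m' s /= /and3P[lm' /forallP le_p' _]] /=; last first.
  have := dsize_move lm' le_p'; have := dsize_apply_gt0 (apply_move p m) lm'.
  by lia.
rewrite ffunE px0 am add0n => /[!lt0b] /eqP xu; rewrite xu; exists v, w.
split=> // [|y py].
  by have := le_p v; rewrite rm eqxx; apply: leq_trans.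
have [|yv] := eqVneq y v; first by left.
have [|yw] := eqVneq y w; first by right.
have : \sum_z ((z == v) + (z == w) + (z == y)) <= dsize p.
  apply: leq_sum => z _; have := le_p z; rewrite rm.
  by case: (eqVneq z y) => [->|_]; rewrite ?addn0 // (negbTE yv) (negbTE yw).
by rewrite !big_split /= !sum_indicator; lia.
Qed.

End RubblingTheory.

Section Weights.
Variables (T : finType) (f : {perm T}).
Implicit Types (c : T -> nat) (x : T).

Let N := #[f]%g.
Let Q := 2 ^ N - 1.

(* The series sum_d 2^-d c (f^d x) is geometric over the cycles of f, so it
   equals cycle_sum c x / (2^N - 1); weight is its integer part. *)
Definition cycle_sum c x := \sum_(d < N) 2 ^ (N - d) * c (iter d f x).

Definition weight c x := cycle_sum c x %/ Q.

Lemma period_gt0 : 0 < Q.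
Proof. by rewrite subn_gt0 -{1}(expn0 2) ltn_exp2l // order_gt0. Qed.

Lemma iter_period x : iter N f x = x.
Proof. by rewrite -permX expg_order perm1. Qed.

Lemma cycle_sumE c x :
  2 * cycle_sum c x = 2 * Q * c x + cycle_sum c (f x).
Proof.
have N_gt0 : 0 < N by apply: order_gt0.
have ->: cycle_sum c (f x) =
    \sum_(d < N) 2 ^ (N - d) * c (iter d.+1 f x).
  by apply: eq_bigr => d _; rewrite iterSr.
have := iter_period x; rewrite /cycle_sum /Q; case: N N_gt0 => // k _ per.
rewrite big_ord_recl big_ord_recr [iter (@ord_max k).+1 _ _]per subSnn /= subn0.
rewrite mulnDr big_distrr /= (eq_bigr (fun i : 'I_k =>
  2 ^ (k.+1 - i) * c (iter i.+1 f x))) => [|i _].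
  have : 0 < 2 ^ k.+1 by rewrite expn_gt0.
  by move: (2 ^ _) (\sum_(_ < _) _) => e s; nia.
by rewrite /bump /= add1n mulnA -expnS -subSn ?subSS // ltnW ?ltnS.
Qed.

Lemma weightE c x : weight c x = c x + (weight c (f x))./2.
Proof.
rewrite /weight -divn2 -divnMA mulnC divnMA divn2 -divnMDl ?period_gt0 //.
congr (_ %/ _); have := cycle_sumE c x; lia.
Qed.

Lemma cycle_sumD c1 c2 x :
  cycle_sum (fun y => c1 y + c2 y) x = cycle_sum c1 x + cycle_sum c2 x.
Proof. by rewrite -big_split; apply: eq_bigr => d _; rewrite mulnDr. Qed.

Lemma eq_cycle_sum c1 c2 x : c1 =1 c2 -> cycle_sum c1 x = cycle_sum c2 x.
Proof. by move=> eq_c; apply: eq_bigr => d _; rewrite eq_c. Qed.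

Lemma leq_cycle_sum k c1 c2 x : (forall y, c1 y <= k * c2 y) ->
  cycle_sum c1 x <= k * cycle_sum c2 x.
Proof.
move=> le_c; rewrite big_distrr /=; apply: leq_sum => d _.
by rewrite mulnCA leq_mul2l le_c orbT.
Qed.

Lemma cycle_sum_shift c x : cycle_sum c (f x) = cycle_sum (c \o f) x.
Proof. by apply: eq_bigr => d _ /=; rewrite -iterSr. Qed.

Lemma leq_weight c1 c2 x a b :
  cycle_sum c1 x + Q * a <= cycle_sum c2 x + Q * b ->
  weight c1 x + a <= weight c2 x + b.
Proof.
move=> /(leq_div2r Q).
rewrite ![_ + Q * _]addnC ![Q * _]mulnC !divnMDl ?period_gt0 //.
by rewrite ![_ + _ %/ _]addnC.
Qed.

End Weights.

Section RungLoad.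
Variables (T : finType) (o : {perm T}).
Hypothesis oK : involutive o.
Hypothesis o_neq : forall x, o x != x.
Implicit Types (u v x : T).

Definition load (p : T -> nat) x := 2 * p x + p (o x).

Definition load1 u x := 2 * (x == u) + (o x == u).

Lemma load1_le2 u x : load1 u x <= 2.
Proof.
rewrite /load1; case: (eqVneq x u) => [->|_]; last by case: eqP.
by rewrite (negbTE (o_neq u)).
Qed.

Lemma load1_o u x : load1 (o u) x <= 2 * load1 u x.
Proof.
rewrite /load1 (inj_eq (can_inj oK)) -(can2_eq oK oK).
by case: (x == u); case: (o x == u).
Qed.

Lemma load1_perm (g : {perm T}) u x :
  (forall y, g (o y) = o (g y)) -> load1 (g u) (g x) = load1 u x.
Proof. by move=> go; rewrite /load1 -go !(inj_eq perm_inj). Qed.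

(* A move v, w -> u is split into v -> u and w -> u, each adding half a pebble
   at u.  Only a half-move from the column of x into that of f x can increase
   the sum at f x, by at most 1 after division by Q. *)
Lemma half_move (f : {perm T}) x u v : (forall y, f (o y) = o (f y)) ->
  let k z := cycle_sum f (load1 z) (f x) in
  let Q := 2 ^ #[f]%g - 1 in
  [/\ v = f u -> k u + 2 * Q * load1 u x = 2 * k v,
      u = f v -> k u <= 2 * k v + 2 * Q * (0 < load1 v x) &
      u = o v -> k u <= 2 * k v].
Proof.
move=> fo k Q.
have kf z : k (f z) = cycle_sum f (load1 z) x.
  rewrite /k cycle_sum_shift; apply: eq_cycle_sum => y /=.
  exact: load1_perm.
have kE z : 2 * k (f z) = 2 * Q * load1 z x + k z.
  by rewrite kf cycle_sumE.
split=> [->|->|->].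
- by rewrite kE addnC.
- have := kE v; have := load1_le2 v x.
  have : 2 * k (f v) >= 2 * Q * load1 v x.
    rewrite [k _]/(cycle_sum _ _ _) cycle_sumE -/Q load1_perm //.
    exact: leq_addr.
  by case: (load1 v x) => [|[|[|]]] //=; nia.
- by apply: leq_cycle_sum => y; apply: load1_o.
Qed.

End RungLoad.

Section LowerBound.
Variables (G : sgraph) (f o : {perm G}).
Hypothesis oK : involutive o.
Hypothesis o_neq : forall x, o x != x.
Hypothesis fo : forall x, f (o x) = o (f x).
Hypothesis adjP :
  forall x y : G, adj x y -> [\/ x = f y, y = f x | y = o x].
Implicit Types (p : distribution G) (x y u v w : G).

Lemma fVo x : f^-1%g (o x) = o (f^-1%g x).
Proof. by apply: (@perm_inj _ f); rewrite fo !permKV. Qed.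

Definition strength p x :=
  weight f (load o p) (f x) + 2 * load o p x +
  weight f^-1%g (load o p) (f^-1%g x).

Lemma half_move_strength x u v : adj v u ->
  let Q := 2 ^ #[f]%g - 1 in let Q' := 2 ^ #[f^-1]%g - 1 in
  let k z := cycle_sum f (load1 o z) (f x) in
  let k' z := cycle_sum f^-1%g (load1 o z) (f^-1%g x) in
  exists a b a' b',
    [/\ k u + 2 * (Q * a) <= 2 * k v + 2 * (Q * b),
        k' u + 2 * (Q' * a') <= 2 * k' v + 2 * (Q' * b') &
        load1 o u x + b + b' <= a + a' + 2 * load1 o v x].
Proof.
move=> vu Q Q' k k'.
have [kl kr ko] := half_move oK o_neq x u v fo.
have [kl' kr' ko'] := half_move oK o_neq x u v fVo.
have [vE|uE|uE] := adjP vu.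
- have uE : u = f^-1%g v by rewrite vE permK.
  exists (load1 o u x), 0, 0, (0 < load1 o v x).
  move: (kl vE) (kr' uE); rewrite -/(k u) -/(k v) -/(k' u) -/(k' v) -/Q -/Q'.
  rewrite !mulnA !muln0 => h1 h2; split; [lia|lia|].
  by case: (load1 o v x) => [|?]; lia.
- have vE : v = f^-1%g u by rewrite uE permK.
  exists 0, (0 < load1 o v x), (load1 o u x), 0.
  move: (kr uE) (kl' vE); rewrite -/(k u) -/(k v) -/(k' u) -/(k' v) -/Q -/Q'.
  rewrite !mulnA !muln0 => h1 h2; split; [lia|lia|].
  by case: (load1 o v x) => [|?]; lia.
- exists 0, 0, 0, 0; rewrite !muln0 !addn0.
  by split; [exact: ko|exact: ko'|rewrite add0n uE load1_o].
Qed.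

Lemma strength_move p m x : legal m -> (forall y, removed m y <= p y) ->
  strength (apply_move p m) x <= strength p x.
Proof.
move=> /legalP[v [w [u [vu wu rm am]]]] le_p; set p' := apply_move p m.
have loadE y : load o p' y + (load1 o v y + load1 o w y) =
    load o p y + load1 o u y.
  have pE z : p' z + ((z == v) + (z == w)) = p z + (z == u).
    by rewrite ffunE am; have := le_p z; rewrite rm; lia.
  by rewrite /load /load1; have := pE y; have := pE (o y); lia.
have sumE (g : {perm G}) y : cycle_sum g (load o p') y +
    (cycle_sum g (load1 o v) y + cycle_sum g (load1 o w) y) =
    cycle_sum g (load o p) y + cycle_sum g (load1 o u) y.
  by rewrite -!cycle_sumD; apply: eq_cycle_sum => z; rewrite loadE.
have [a [b [a' [b' [k1 k1' le1]]]]] := half_move_strength x vu.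
have [c [d [c' [d' [k2 k2' le2]]]]] := half_move_strength x wu.
have le_f : weight f (load o p') (f x) + (a + c) <=
    weight f (load o p) (f x) + (b + d).
  by apply: leq_weight; have := sumE f (f x); rewrite !mulnDr; lia.
have le_f' : weight f^-1%g (load o p') (f^-1%g x) + (a' + c') <=
    weight f^-1%g (load o p) (f^-1%g x) + (b' + d').
  by apply: leq_weight; have := sumE f^-1%g (f^-1%g x); rewrite !mulnDr; lia.
by have := loadE x; rewrite /strength; lia.
Qed.

Lemma reachable_strength p x : reachable p x -> 4 <= strength p x.
Proof.
case=> s; elim: s p => [|m s IHs] p /=.
  by rewrite /strength /load; lia.
case/and3P=> lm /forallP le_p ex_s /(IHs _ ex_s) le4.
exact: leq_trans le4 (strength_move _ lm le_p).
Qed.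

Lemma load_weight_le2 (g : {perm G}) p x : (forall y, g (o y) = o (g y)) ->
  weight g (load o p) x <= 2 * weight g (load o p) (o x) + 1.
Proof.
move=> go.
suff : weight g (load o p) x < 2 * (weight g (load o p) (o x)).+1 by lia.
rewrite ltn_divLR ?period_gt0 // -mulnA.
apply: (@leq_ltn_trans (2 * cycle_sum g (load o p) (o x))); last first.
  by rewrite ltn_pmul2l // ltn_ceil // period_gt0.
have iter_o d : iter d g (o x) = o (iter d g x).
  by elim: d => //= d ->.
rewrite big_distrr; apply: leq_sum => d _ /=; rewrite mulnCA leq_mul2l iter_o.
by rewrite /load oK; apply/orP; right; lia.
Qed.

Let s (g : {perm G}) p x := weight g (load o p) x + weight g (load o p) (o x).

Lemma local_bound p x : solvable p ->
  4 + (s f p x - 2) + (s f^-1%g p x - 2) <=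
  6 * (p x + p (o x)) + (s f p (f x) - 2) + (s f^-1%g p (f^-1%g x) - 2).
Proof.
move=> sol_p; have := reachable_strength (sol_p x).
have := reachable_strength (sol_p (o x)); rewrite /strength /s.
rewrite !fo !fVo !(weightE _ _ x) !(weightE _ _ (o x)) !fo !fVo.
have h1 := load_weight_le2 p (f x) fo.
have h2 := load_weight_le2 p (o (f x)) fo.
have h3 := load_weight_le2 p (f^-1%g x) fVo.
have h4 := load_weight_le2 p (o (f^-1%g x)) fVo.
move: h1 h2 h3 h4; rewrite !oK.
move: (weight f _ (f x)) (weight f _ (o (f x))) => d e.
move: (weight _ _ (f^-1%g x)) (weight _ _ (o (f^-1%g x))) => d' e'.
rewrite /load oK; move: (p x) (p (o x)) => a b.
by lia.
Qed.

Lemma solvable_size_ge p : solvable p -> #|G| <= 3 * dsize p.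
Proof.
move=> sol_p.
have sum_perm (g : {perm G}) (F : G -> nat) : \sum_x F (g x) = \sum_x F x.
  by rewrite [RHS](reindex_inj (@perm_inj _ g)).
have : \sum_(x : G) (4 + (s f p x - 2) + (s f^-1%g p x - 2)) <=
    \sum_(x : G) (6 * (p x + p (o x)) + (s f p (f x) - 2) +
                (s f^-1%g p (f^-1%g x) - 2)).
  by apply: leq_sum => x _; apply: local_bound.
have -> : \sum_(x : G) (6 * (p x + p (o x)) + (s f p (f x) - 2) +
    (s f^-1%g p (f^-1%g x) - 2)) = 12 * dsize p +
    \sum_x (s f p x - 2) + \sum_x (s f^-1%g p x - 2).
  rewrite !big_split (sum_perm f (fun x => s f p x - 2)) /=.
  rewrite (sum_perm f^-1%g (fun x => s f^-1%g p x - 2)).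
  by rewrite big1_eq (sum_perm o p) /dsize /=; lia.
rewrite 2!big_split /= sum_nat_const.
by rewrite !leq_add2r -[#|xpredT|]/(#|G|) (_ : 12 = 3 * 4) // mulnAC leq_pmul2r.
Qed.

Lemma solvable_size_ge3 p : 5 < #|G| -> solvable p -> 2 < dsize p.
Proof.
move=> card_G sol_p; rewrite ltnNge; apply/negP=> le2.
have le_supp (q : distribution G) : #|[set x | 0 < q x]| <= dsize q.
  rewrite -sum1_card big_mkcond /=; apply: leq_sum => x _.
  by rewrite inE; case: (q x).
have [B cardB subB] : exists2 B : {set G},
    #|B| <= 3 & forall x, p x = 0 -> x \in B.
  have [v pv|p0] := pickP (fun v => 0 < p v); last first.
    exists set0 => [|x px0]; first by rewrite cards0.
    have [v [_ [pv _ _ _]]] := reachable_two le2 px0 (sol_p x).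
    by rewrite p0 in pv.
  exists [set f v; f^-1%g v; o v] => [|x px0].
    by rewrite -setUA cardsU1 cards2; case: (_ \notin _); case: (_ != _).
  have [v1 [w1 [_ v1x w1x sub_vw]]] := reachable_two le2 px0 (sol_p x).
  have vx : adj v x by case: (sub_vw _ pv) => ->.
  rewrite !inE; case: (adjP vx) => ->; rewrite ?permK ?eqxx ?orbT //.
have subG : [set: G] \subset [set x | 0 < p x] :|: B.
  apply/subsetP=> x _; rewrite !inE; have [//|] := ltnP 0 (p x).
  by rewrite leqn0 => /eqP /subB.
have := subset_leq_card subG; rewrite cardsT cardsU.
by have := le_supp p; lia.
Qed.

End LowerBound.

Section TwistedPrism.
Variables (t : bool) (n : nat).

(* prism n for t = false and moebius_ladder n for t = true, both up to
   conversion. *)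
Definition twisted_prism : sgraph :=
  graph_of_edges [rel x y : 'I_n * bool |
    ladder_edge x y || first_last x y && (t (+) (x.2 == y.2))].

Definition next (x : twisted_prism) : twisted_prism :=
  (ordS x.1, x.2 (+) (t && (x.1.+1 == n))).

Definition rung (x : twisted_prism) : twisted_prism := (x.1, ~~ x.2).

Lemma next_inj : injective next.
Proof.
move=> [i a] [j b] eq_ij.
have ij : i = j by apply: ordS_inj; have := congr1 fst eq_ij.
by move: eq_ij; rewrite ij => /(congr1 snd) /addIb /= ->.
Qed.

Lemma rungK : involutive rung.
Proof. by case=> i a; rewrite /rung /= negbK. Qed.

Lemma rung_neq x : rung x != x.
Proof. by case: x => i a; rewrite xpair_eqE eqxx /=; case: a. Qed.

Lemma next_rung x : next (rung x) = rung (next x).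
Proof. by rewrite /next /rung /= addNb. Qed.

Lemma twisted_prism_adjP (x y : twisted_prism) :
  adj x y -> [\/ x = next y, y = next x | y = rung x].
Proof.
have edge (z1 z2 : twisted_prism) :
    ladder_edge z1 z2 || first_last z1 z2 && (t (+) (z1.2 == z2.2)) ->
    [\/ z1 = next z2, z2 = next z1 | z2 = rung z1].
  case: z1 z2 => [i a] [j b]; rewrite /ladder_edge /first_last /=.
  case/orP=> [/orP[/andP[/eqP<- /eqP ij]|/andP[/eqP<- ab]]|].
  - constructor 2; congr pair; last by rewrite ij ltn_eqF // andbF addbF.
    by apply: val_inj; rewrite /= -ij modn_small // ij.
  - by constructor 3; congr pair; case: a b ab => [] [].
  - case/andP=> /andP[/eqP i0 /eqP jn] ab; constructor 1; congr pair.
      by apply: val_inj; rewrite /= jn modnn.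
    by rewrite jn eqxx andbT; case: t a b ab => [] [] [].
case/andP=> _ /orP[] /edge[] h; [exact: Or31|exact: Or32|exact: Or33| | |].
- exact: Or32.
- exact: Or31.
- by apply: Or33; rewrite h rungK.
Qed.

Lemma card_twisted_prism : #|twisted_prism| = 2 * n.
Proof. by rewrite card_prod card_ord card_bool mulnC. Qed.

Lemma twisted_prism_size_ge (p : distribution twisted_prism) : 2 < n ->
  solvable p -> (if n == 3 then 3 else (2 * n + 2) %/ 3) <= dsize p.
Proof.
move=> n_gt2 sol_p; pose f := perm next_inj; pose o := perm (inv_inj rungK).
have oK : involutive o by move=> x; rewrite !permE rungK.
have o_neq x : o x != x by rewrite permE rung_neq.
have fo x : f (o x) = o (f x) by rewrite !permE next_rung.
have adjP x y : adj x y -> [\/ x = f y, y = f x | y = o x].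
  by rewrite !permE; apply: twisted_prism_adjP.
have := solvable_size_ge oK o_neq fo adjP sol_p.
have := solvable_size_ge3 adjP _ sol_p; rewrite card_twisted_prism.
by case: eqP => [->|_]; lia.
Qed.

End TwistedPrism.

Section UpperBound.
Variables (t : bool) (n : nat).
Notation H := (twisted_prism t n).
Implicit Types (i j k : 'I_n) (s : bool).

Lemma adj_rung i s s' : s != s' -> @adj H (i, s) (i, s').
Proof.
move=> ss'; rewrite /= /edges_adj /ladder_edge /= xpair_eqE eqxx /=.
by rewrite ss' orbT.
Qed.

Lemma adj_next i j s : i.+1 = j -> @adj H (i, s) (j, s).
Proof.
move=> ij; rewrite /= /edges_adj /ladder_edge /= xpair_eqE -val_eqE /= -ij.
by rewrite !eqxx ltn_eqF.
Qed.

Lemma adj_wrap i j s : 0 < i -> i.+1 = n -> j = 0 :> nat ->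
  @adj H (j, s (+) t) (i, s).
Proof.
move=> i_gt0 iE j0; rewrite /= /edges_adj /first_last /= xpair_eqE -val_eqE /=.
rewrite j0 iE (ltn_eqF i_gt0) !eqxx /=.
by apply/orP; left; apply/orP; right; case: s; case: t.
Qed.

Lemma block_reachable i j s : i.+1 = j ->
  reachable (@pebbles H [:: (i, false); (j, true)]) (i, s) /\
  reachable (@pebbles H [:: (i, false); (j, true)]) (j, s).
Proof.
move=> ij; have ijs s' := adj_next s' ij.
split; case: s.
- by apply: (@pebbles_join H [:: (i, false)] [:: (j, true)]
    (i, false) (j, true)); rewrite ?adj_rung // 1?adj_sym //; exact: pebbles1.
- by apply: reachable_pebbled; rewrite ffunE /= eqxx.
- by apply: reachable_pebbled; rewrite ffunE /= eqxx addnA addn1.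
- by apply: (@pebbles_join H [:: (i, false)] [:: (j, true)]
    (i, false) (j, true)); rewrite ?adj_rung //; exact: pebbles1.
Qed.

Definition diagonals : distribution H :=
  [ffun x : 'I_n * bool => nat_of_bool (x.1 %% 3 == x.2 :> nat)].

Lemma dsize_diagonals : dsize diagonals = (2 * n + 2) %/ 3.
Proof.
have -> : dsize diagonals = \sum_(x : 'I_n * bool) (x.1 %% 3 == x.2 :> nat).
  by apply: eq_bigr => x _; rewrite ffunE.
rewrite -(pair_bigA _ (fun i s =>
  nat_of_bool (val i %% 3 == nat_of_bool s))) /=.
under eq_bigr do rewrite big_bool /=.
elim: n => [|k IHk]; first by rewrite big_ord0.
by rewrite big_ord_recr /= IHk; lia.
Qed.

Lemma reachable_diagonals (l : seq H) (x : H) : uniq l ->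
  all (fun y : 'I_n * bool => y.1 %% 3 == y.2 :> nat) l ->
  reachable (pebbles l) x -> reachable diagonals x.
Proof.
move=> uniq_l /allP sub_l; apply: reachable_pebbles; apply/allP=> y yl.
by rewrite count_uniq_mem // yl ffunE (sub_l y yl).
Qed.

Lemma ord_pred_ex i : 0 < i -> exists j, j.+1 = i.
Proof. by case: i => [[|i] Hi] // _; exists (Ordinal (ltnW Hi)). Qed.

(* A block {(0, _), (1, _)} contains the right neighbour of column n - 1. *)
Lemma gap_right i s : 4 < n -> i %% 3 = 2 -> exists (l : seq H) (w : H),
  [/\ uniq l, all (fun y : 'I_n * bool => (y.1 %% 3 == y.2 :> nat) &&
        ((i < y.1) || (y.1.+2 < i))) l,
      reachable (pebbles l) w & adj w ((i, s) : H)].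
Proof.
move=> n_gt4 i2; have n_gt0 : 0 < n by lia.
have n_gt1 : 1 < n by lia.
have first s' := @block_reachable (Ordinal n_gt0) (Ordinal n_gt1) s' erefl.
have i_le := ltn_ord i.
have [lt_i1|ge_i1] := ltnP i.+1 n; last first.
  exists [:: (Ordinal n_gt0, false); (Ordinal n_gt1, true)].
  exists (Ordinal n_gt0, s (+) t); split=> //.
  - by rewrite /= !andbT; lia.
  - by have [] := first (s (+) t).
  - by apply: adj_wrap => //; lia.
have adj_i1 s' : @adj H (Ordinal lt_i1, s') (i, s').
  by rewrite adj_sym adj_next.
have [lt_i2|ge_i2] := ltnP i.+2 n.
  exists [:: (Ordinal lt_i1, false); (Ordinal lt_i2, true)].
  exists (Ordinal lt_i1, s); split=> //.
  - by rewrite /= inE xpair_eqE andbF.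
  - by rewrite /= !andbT; lia.
  - by have [] := @block_reachable (Ordinal lt_i1) (Ordinal lt_i2) s erefl.
case: s => [|]; last first.
  exists [:: (Ordinal lt_i1, false)], (Ordinal lt_i1, false).
  by split=> //; [rewrite /= andbT; lia|exact: pebbles1].
exists [:: (Ordinal lt_i1, false); (Ordinal n_gt0, false);
           (Ordinal n_gt1, true)].
exists (Ordinal lt_i1, true); split=> //.
- by rewrite /= !inE !xpair_eqE -!val_eqE /=; lia.
- by rewrite /= !andbT; lia.
- apply: (@pebbles_join H [:: (Ordinal lt_i1, false)]
    [:: (Ordinal n_gt0, false); (Ordinal n_gt1, true)]
    (Ordinal lt_i1, false) (Ordinal n_gt0, true (+) t)).
  + exact: pebbles1.
  + by have [] := first (true (+) t).
  + exact: adj_rung.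
  + by apply: adj_wrap => //=; lia.
Qed.

Lemma solvable_diagonals : 4 < n -> solvable diagonals.
Proof.
move=> n_gt4 [i s]; have n_gt0 : 0 < n by lia.
have n_gt1 : 1 < n by lia.
have i_le := ltn_ord i.
have : i %% 3 < 3 by rewrite ltn_mod.
case i3 : (i %% 3) => [|[|[|//]]] _.
- case: s; last by apply: reachable_pebbled; rewrite ffunE /= i3.
  have [lt_i1|ge_i1] := ltnP i.+1 n.
    apply: (@reachable_diagonals [:: (i, false); (Ordinal lt_i1, true)]).
    + by rewrite /= inE xpair_eqE andbF.
    + by rewrite /= !andbT; lia.
    + by have [] := @block_reachable i (Ordinal lt_i1) true erefl.
  apply: (@reachable_diagonals
    [:: (i, false); (Ordinal n_gt0, false); (Ordinal n_gt1, true)]).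
  + by rewrite /= !inE !xpair_eqE -!val_eqE /=; lia.
  + by rewrite /= !andbT; lia.
  + apply: (@pebbles_join H [:: (i, false)]
      [:: (Ordinal n_gt0, false); (Ordinal n_gt1, true)]
      (i, false) (Ordinal n_gt0, true (+) t)).
    * exact: pebbles1.
    * by have [] := @block_reachable (Ordinal n_gt0) (Ordinal n_gt1)
        (true (+) t) erefl.
    * exact: adj_rung.
    * by apply: adj_wrap => //=; lia.
- have [j ij] : exists j, j.+1 = i by apply: ord_pred_ex; lia.
  apply: (@reachable_diagonals [:: (j, false); (i, true)]).
  + by rewrite /= inE xpair_eqE andbF.
  + by rewrite /= !andbT; lia.
  + by have [] := block_reachable s ij.
- have [j ij] : exists j, j.+1 = i by apply: ord_pred_ex; lia.
  have [k jk] : exists k, k.+1 = j by apply: ord_pred_ex; lia.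
  have [l [w [uniq_l all_l reach_w adj_w]]] := gap_right s n_gt4 i3.
  apply: (@reachable_diagonals ([:: (k, false); (j, true)] ++ l)).
  + rewrite cat_uniq uniq_l andbT /= inE xpair_eqE andbF /=.
    apply/hasPn=> y /(allP all_l) /andP[_ y_i]; apply/negP.
    rewrite !inE => /orP[] /eqP yE; move: y_i; rewrite yE /=; lia.
  + rewrite all_cat /= andbT; apply/andP; split; first by lia.
    by apply/allP=> y /(allP all_l) /andP[].
  + apply: (@pebbles_join H [:: (k, false); (j, true)] l (j, s) w) => //.
      by have [] := block_reachable s jk.
    exact: adj_next.
Qed.

End UpperBound.

Definition three_pebbles t : distribution (twisted_prism t 3) :=
  @pebbles (twisted_prism t 3)
    [:: (@Ordinal 3 0 isT, false); (@Ordinal 3 1 isT, true);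
        (@Ordinal 3 2 isT, false)].

Lemma solvable_three_pebbles t : solvable (three_pebbles t).
Proof.
have first s :=
  @block_reachable t 3 (@Ordinal 3 0 isT) (@Ordinal 3 1 isT) s erefl.
case=> [[[|[|[|//]]] Hi] s]; rewrite (bool_irrelevance Hi isT).
- by apply: reachable_pebbles (first s).1; rewrite /= !ffunE.
- by apply: reachable_pebbles (first s).2; rewrite /= !ffunE.
- case: s; last by apply: reachable_pebbled; rewrite ffunE.
  pose b : twisted_prism t 3 := (@Ordinal 3 1 isT, true).
  pose c : twisted_prism t 3 := (@Ordinal 3 2 isT, false).
  apply: (@reachable_pebbles _ _ [:: b; c]); first by rewrite /= !ffunE.
  by apply: (@pebbles_join _ [:: b] [:: c] b c) => //; apply: pebbles1.
Qed.

Lemma solvable_prism4 : exists2 p : distribution (twisted_prism false 4),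
  solvable p & dsize p = 3.
Proof.
pose x i (Hi : i < 4) s : twisted_prism false 4 := (Ordinal Hi, s).
pose a := x 0 isT false; pose b := x 2 isT true.
exists (pebbles [:: a; a; b]); last by rewrite dsize_pebbles.
have ra y : adj a y -> reachable (pebbles [:: a; a]) y.
  move=> ay; apply: (@pebbles_join _ [:: a] [:: a] a a) => //;
  exact: pebbles1.
have rb y z : adj a y -> adj y z -> adj b z ->
    reachable (pebbles [:: a; a; b]) z.
  move=> ay yz bz; apply: (@pebbles_join _ [:: a; a] [:: b] y b) => //.
    exact: ra.
  exact: pebbles1.
have ra' y : adj a y -> reachable (pebbles [:: a; a; b]) y.
  by move/ra; apply: reachable_pebbles; rewrite /= !ffunE.
case=> [[[|[|[|[|//]]]] Hi] []]; rewrite (bool_irrelevance Hi isT).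
- exact: ra'.
- by apply: reachable_pebbled; rewrite ffunE.
- exact: (rb (x 1 isT false)).
- exact: ra'.
- by apply: reachable_pebbled; rewrite ffunE.
- exact: (rb (x 1 isT false)).
- exact: (rb (x 3 isT false)).
- exact: ra'.
Qed.

Lemma solvable_moebius4 : exists2 p : distribution (twisted_prism true 4),
  solvable p & dsize p = 3.
Proof.
pose x i (Hi : i < 4) s : twisted_prism true 4 := (Ordinal Hi, s).
pose a := x 0 isT false; pose b := x 3 isT false; pose c := x 2 isT true.
exists (pebbles [:: a; b; c]); last by rewrite dsize_pebbles.
have pair y z w : adj y w -> adj z w -> reachable (pebbles [:: y; z]) w.
  by apply: (@pebbles_join _ [:: y] [:: z]); apply: pebbles1.
case=> [[[|[|[|[|//]]]] Hi] []]; rewrite (bool_irrelevance Hi isT).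
- by apply: (@reachable_pebbles _ _ [:: a; b]); [rewrite /= !ffunE|exact: pair].
- by apply: reachable_pebbled; rewrite ffunE.
- apply: (@pebbles_join _ [:: a; b] [:: c] (x 0 isT true) c) => //.
    exact: pair.
  exact: pebbles1.
- apply: (@pebbles_join _ [:: a] [:: b; c] a (x 2 isT false)) => //.
    exact: pebbles1.
  exact: pair.
- by apply: reachable_pebbled; rewrite ffunE.
- by apply: (@reachable_pebbles _ _ [:: b; c]); [rewrite /= !ffunE|exact: pair].
- by apply: (@reachable_pebbles _ _ [:: a; b]); [rewrite /= !ffunE|exact: pair].
- by apply: reachable_pebbled; rewrite ffunE.
Qed.

Lemma optimal_rubbling_twisted_prism t n : 2 < n ->
  optimal_rubbling_number (twisted_prism t n) =
  if n == 3 then 3 else (2 * n + 2) %/ 3.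
Proof.
move=> n_gt2; apply: optimal_rubbling_numberP; last first.
  by move=> p; apply: twisted_prism_size_ge.
have [->|n_neq3] := eqVneq n 3.
  exists (three_pebbles t); first exact: solvable_three_pebbles.
  exact: dsize_pebbles.
have [->|n_neq4] := eqVneq n 4.
  by case: t; [exact: solvable_moebius4|exact: solvable_prism4].
exists (diagonals t n); last exact: dsize_diagonals.
by apply: solvable_diagonals; lia.
Qed.

Theorem theorem4 (n : nat) (hn : 3 <= n) :
  optimal_rubbling_number (moebius_ladder n) =
  optimal_rubbling_number (prism n).
Proof.
rewrite -[moebius_ladder n]/(twisted_prism true n).
rewrite -[prism n]/(twisted_prism false n).
by rewrite !optimal_rubbling_twisted_prism.
Qed.
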